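(* Let $\kappa$ be an infinite cardinal and let $G=\bigcup_{\alpha<\kappa}G_\alpha$ be a group of cardinality $\kappa$ which is the limit of regular representations of length $\kappa$ with base $G_0=Sym(n)$ for some $n\ge 7$, with $|G_\alpha|<\kappa$ for all $\alpha<\kappa$. Let $A\subseteq\kappa$ be a club subset, enumerated increasingly by $(a_\alpha:\alpha<\kappa)$. Let $\mathcal{G}_A$ be the group and, for $\mathbf{g}\in\mathcal{G}_A$, let $\Phi^{\mathbf{g}}$ be the $A$-level preserving automorphism of $G$, both defined in the context. Then the map $\Theta:\mathcal{G}_A\to Aut_A(G)$, $\Theta(\mathbf{g})=\Phi^{\mathbf{g}}$, is a monomorphism of groups.
   Context: Limit of regular representations of length $\kappa$ with base $G_0$: $G_{\alpha+1}=Sym(G_\alpha)$ with $G_\alpha\hookrightarrow G_{\alpha+1}$ via its right regular representation for all $\alpha<\kappa$ (products in symmetric groups are compositions of functions, and $x\in G_\alpha$ corresponds to the permutation $y\mapsto yx^{-1}$), and $G_\gamma=\varinjlim_{\alpha<\gamma}G_\alpha$ for limit $\gamma<\kappa$; $G$ is the direct limit of all $G_\alpha$. Each $G_\alpha$ is identified with its image, so $G_\alpha\leqslant G_\beta\leqslant G$ for $\alpha<\beta<\kappa$ and $G_\gamma=\bigcup_{\alpha<\gamma}G_\alpha$ for limit $\gamma$. A club subset of $\kappa$ is a closed and unbounded subset; $A$ is assumed to have an increasing enumeration $(a_\alpha:\alpha<\kappa)$ of length $\kappa$ (so $a_\gamma=\sup_{\alpha<\gamma}a_\alpha$ for limit $\gamma$).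 The ordinal $0$ is non-limit. $Aut(G)$ is a group under composition, and $Aut_A(G)$ is the subgroup of all $\varphi\in Aut(G)$ with $\varphi[G_\alpha]=G_\alpha$ for all $\alpha\in A$ (the $A$-level preserving automorphisms). $\mathbf{C}_L(H)$ is the centralizer of $H$ in $L$; set $G_{a_{-1}}=\{1_G\}$, so $\mathbf{C}_{G_{a_0}}(G_{a_{-1}})=G_{a_0}$. Write $\iota_g(x)=gxg^{-1}$. As a set, $\mathcal{G}_A=\prod_{\alpha<\kappa,\ \alpha\text{ non-limit}}\mathbf{C}_{G_{a_\alpha}}(G_{a_{\alpha-1}})$. For $\mathbf{g}=(g_\alpha:\alpha<\kappa,\ \alpha\text{ non-limit})\in\mathcal{G}_A$ define automorphisms $\Phi^{\mathbf{g}}_\alpha$ of $G$ ($\alpha<\kappa$) recursively: $\Phi^{\mathbf{g}}_0=\iota_{g_0}$; $\Phi^{\mathbf{g}}_{\alpha+1}=\iota_{g_{\alpha+1}}\circ\Phi^{\mathbf{g}}_\alpha$; for limit $\gamma<\kappa$, let $\Psi^{\mathbf{g}}_\gamma=\bigcup_{\alpha<\gamma}(\Phi^{\mathbf{g}}_\alpha\upharpoonright G_{a_\alpha})$, an automorphism of $G_{a_\gamma}$, let $\psi^{\mathbf{g}}_\gamma\in G_{a_\gamma+1}=Sym(G_{a_\gamma})$ be this permutation regarded as an element of $G$, and set $\Phi^{\mathbf{g}}_\gamma=\iota_{\psi^{\mathbf{g}}_\gamma}$. These satisfy $\Phi^{\mathbf{g}}_\alpha[G_{a_\delta}]=G_{a_\delta}$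 and $\Phi^{\mathbf{g}}_\beta\upharpoonright G_{a_\beta}=\Phi^{\mathbf{g}}_\alpha\upharpoonright G_{a_\beta}$ for all $\beta<\alpha\le\delta<\kappa$. Put $\Phi^{\mathbf{g}}=\bigcup_{\alpha<\kappa}(\Phi^{\mathbf{g}}_\alpha\upharpoonright G_{a_\alpha})$, an element of $Aut_A(G)$. The multiplication on $\mathcal{G}_A$ is $\mathbf{g}\cdot\mathbf{h}=(g_\alpha\,\Phi^{\mathbf{g}}_{\alpha-1}(h_\alpha):\alpha<\kappa,\ \alpha\text{ non-limit})$, where $\Phi^{\mathbf{g}}_{-1}(h_0)=h_0$; this makes $\mathcal{G}_A$ a group. *)

(* Defs.v *)
From HB Require Import structures.
From mathcomp Require Import all_boot all_order.
From mathcomp Require Import boolp classical_sets functions cardinality.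

Set Implicit Arguments.
Unset Strict Implicit.
Unset Printing Implicit Defensive.

Local Open Scope classical_set_scope.
Local Open Scope card_scope.
Local Open Scope group_scope.

(* The product of Sym T is composition of functions, (s * t) x = s (t x); it is
   opposite to the product of {perm T}. *)
Record Sym (T : Type) := MkSym {
  sym_fun :> T -> T;
  sym_bij : bijective sym_fun }.

Section SymGroup.
Variable T : Type.
Implicit Types s t u : Sym T.

Lemma sym_ext s t : s =1 t -> s = t.
Proof.
case: s t => [f fb] [g gb] /= /funext fg; subst g.
by rewrite (Prop_irrelevance fb gb).
Qed.

HB.instance Definition _ := gen_eqMixin (Sym T).
HB.instance Definition _ := gen_choiceMixin (Sym T).

Definition sym_one : Sym T := @MkSym T id (Bijective (fun=> erefl) (fun=> erefl)).

Definition sym_mul s t : Sym T := MkSym (bij_comp (sym_bij s) (sym_bij t)).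

Lemma sym_inv_ex s : exists t, cancel s t /\ cancel t s.
Proof.
by case: (sym_bij s) => g fK gK; exists (MkSym (Bijective gK fK)); split.
Qed.

Definition sym_inv s : Sym T := projT1 (cid (sym_inv_ex s)).

Lemma sym_mulA : associative sym_mul.
Proof. by move=> s t u; apply: sym_ext. Qed.

Lemma sym_mul1 : left_id sym_one sym_mul.
Proof. by move=> s; apply: sym_ext. Qed.

Lemma sym_mulr1 : right_id sym_one sym_mul.
Proof. by move=> s; apply: sym_ext. Qed.

Lemma sym_mulV : left_inverse sym_one sym_inv sym_mul.
Proof.
move=> s; apply: sym_ext => x /=.
by have [sK _] := projT2 (cid (sym_inv_ex s)); apply: sK.
Qed.

Lemma sym_mulrV : right_inverse sym_one sym_inv sym_mul.
Proof.
move=> s; apply: sym_ext => x /=.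
by have [_ sK] := projT2 (cid (sym_inv_ex s)); apply: sK.
Qed.

HB.instance Definition _ := isGroup.Build (Sym T)
  sym_mulA sym_mul1 sym_mulr1 sym_mulV sym_mulrV.

Lemma sym_mulE s t x : (s * t) x = s (t x).
Proof. by []. Qed.

End SymGroup.

Section Ordinals.
Variables (d : Order.disp_t) (K : orderType d).
Implicit Types (alpha beta gamma : K) (A : set K).

(* An infinite cardinal is represented by a well-order K of its order type: K
   is an initial ordinal, i.e. its proper initial segments are smaller than it.
   The elements of K are then the ordinals below the cardinal. *)
Record infinite_cardinal : Prop := {
  cardinal_wf : well_founded (fun alpha beta => (alpha < beta)%O);
  cardinal_infinite : infinite_set [set: K];
  cardinal_initial :
    forall alpha, ~ ([set: K] #<= [set beta | (beta < alpha)%O]) }.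

Definition is_zero alpha : Prop := forall beta, (alpha <= beta)%O.

(* beta is the immediate successor of alpha *)
Definition is_succ alpha beta : Prop :=
  (alpha < beta)%O /\ forall gamma, (alpha < gamma)%O -> (beta <= gamma)%O.

Definition is_limit gamma : Prop :=
  ~ is_zero gamma /\ forall alpha, ~ is_succ alpha gamma.

(* In an infinite cardinal every element has an immediate successor, so the
   default value of xget is not used. *)
Definition next alpha : K := xget alpha [set beta | is_succ alpha beta].

(* None for 0 (where it stands for the index -1) and for limits *)
Definition prev alpha : option {beta | is_succ beta alpha} :=
  match pselect (exists beta, is_succ beta alpha) with
  | left ex => Some (exist _ (projT1 (cid ex)) (projT2 (cid ex)))
  | right _ => None
  end.

Definition nonlimit : Type := {alpha : K | ~ is_limit alpha}.

Definition club A : Prop :=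
  (forall alpha, exists2 beta, A beta & (alpha < beta)%O) /\
  (forall gamma, is_limit gamma ->
     (forall alpha, (alpha < gamma)%O ->
        exists2 beta, A beta & (alpha < beta < gamma)%O) ->
     A gamma).

Definition increasing_enum (a : K -> K) A : Prop :=
  {homo a : alpha beta / (alpha < beta)%O} /\ range a = A.

End Ordinals.

(* The levels are identified with their images in the direct limit G, so they
   are subgroups of G.  [perm_elt alpha] is the identification of
   Sym(G_alpha) with G_(alpha+1): it sends the permutation y |-> y x^-1 of
   G_alpha to x itself. *)
Record regular_limit (d : Order.disp_t) (K : orderType d) (B G : groupType) := {
  level : K -> set G;
  perm_elt : forall alpha : K, {multiplicative Sym (level alpha) -> G};
  level_group : forall alpha, group_closed [in level alpha];
  level_mono : forall alpha beta, (alpha <= beta)%O ->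
    level alpha `<=` level beta;
  level_base : forall alpha, is_zero alpha ->
    exists f : {multiplicative B -> G}, injective f /\ range f = level alpha;
  level_next : forall alpha,
    injective (perm_elt alpha) /\ range (perm_elt alpha) = level (next alpha);
  level_regular : forall alpha (x : level alpha) (s : Sym (level alpha)),
    (forall y : level alpha, val (s y) = val y * (val x)^-1) ->
    perm_elt alpha s = val x;
  level_limit : forall gamma, is_limit gamma ->
    level gamma = \bigcup_(alpha in [set alpha | (alpha < gamma)%O]) level alpha;
  level_union : \bigcup_alpha level alpha = [set: G] }.

Definition centralizer_in (G : groupType) (L H : set G) : set G :=
  [set x | L x /\ forall y, H y -> commute x y].

(* iota_g; the library's x ^ g is g^-1 x g *)
Definition inner (G : groupType) (g x : G) : G := g * x * g^-1.

Section LevelPreserving.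
Variables (d : Order.disp_t) (K : orderType d) (kappa : infinite_cardinal K).
Variables (B G : groupType) (T : regular_limit K B G).

Definition AutA (A : set K) : set (G -> G) :=
  [set phi | [/\ bijective phi, {morph phi : x y / x * y} &
     forall alpha, A alpha -> phi @` level T alpha = level T alpha]].

Variable a : K -> K.

(* G_(a_(alpha-1)), with G_(a_(-1)) the trivial group *)
Definition prev_level (alpha : K) : set G :=
  match prev alpha with
  | Some (exist beta _) => level T (a beta)
  | None => [set 1]
  end.

Definition GA : set (nonlimit K -> G) :=
  [set g | forall alpha : nonlimit K,
     centralizer_in (level T (a (sval alpha))) (prev_level (sval alpha))
       (g alpha)].

(* the union of the graphs of the restrictions of F_alpha to G_(a_alpha), for
   alpha in P, as a function that is the identity outside the domain of this
   union *)
Definition glue (P : K -> Prop) (F : forall alpha, P alpha -> G -> G) (x : G) : G :=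
  xget x [set y | exists alpha (Palpha : P alpha),
    level T (a alpha) x /\ y = F alpha Palpha x].

(* the element of Sym(G_alpha) = G_(alpha+1) that is the restriction of f to
   G_alpha, if this restriction is a permutation of G_alpha *)
Definition as_element (alpha : K) (f : G -> G) : G :=
  xget 1 [set p | exists s : Sym (level T alpha),
    (forall x : level T alpha, val (s x) = f (val x)) /\ p = perm_elt T alpha s].

Section Phi.
Variable g : nonlimit K -> G.

Definition Phi_step (alpha : K)
    (Phi : forall beta, (beta < alpha)%O -> G -> G) : G -> G :=
  match pselect (is_limit alpha) with
  | left _ => inner (as_element (a alpha) (glue Phi))
  | right nl =>
      inner (g (exist _ alpha nl)) \o
      match prev alpha with
      | Some (exist beta beta_succ) => Phi beta (proj1 beta_succ)
      | None => id
      end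
  end.

Definition Phi_at : K -> G -> G :=
  Fix (cardinal_wf kappa) (fun=> G -> G) Phi_step.

(* Phi_(alpha-1), with Phi_(-1) the identity *)
Definition Phi_prev (alpha : K) : G -> G :=
  match prev alpha with
  | Some (exist beta _) => Phi_at beta
  | None => id
  end.

Definition Phi : G -> G := glue (fun alpha (_ : True) => Phi_at alpha).

End Phi.

Definition mulGA (g h : nonlimit K -> G) : nonlimit K -> G :=
  fun alpha => g alpha * Phi_prev g (sval alpha) (h alpha).

End LevelPreserving.

(* Groups given by an operation on a set of elements of X.  A monomorphism
   includes that its source and target are groups. *)
Definition is_group (X : Type) (S : set X) (op : X -> X -> X) : Prop :=
  [/\ forall x y, S x -> S y -> S (op x y),
      forall x y z, S x -> S y -> S z -> op x (op y z) = op (op x y) z &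
      exists e, [/\ S e,
        forall x, S x -> op e x = x /\ op x e = x &
        forall x, S x -> exists y, [/\ S y, op y x = e & op x y = e]]].

Definition group_monomorphism (X Y : Type) (S : set X) (opS : X -> X -> X)
    (R : set Y) (opR : Y -> Y -> Y) (f : X -> Y) : Prop :=
  [/\ is_group S opS, is_group R opR,
      forall x, S x -> R (f x),
      forall x y, S x -> S y -> f (opS x y) = opR (f x) (f y) &
      forall x y, S x -> S y -> f x = f y -> x = y].

(* Main.v *)
Require Import Defs.
From mathcomp Require Import all_boot all_order.
From mathcomp Require Import boolp classical_sets functions cardinality.

(* By recursion every [Phi_at alpha] is an inner automorphism [inner p], where
   [p] lies in all levels [a delta] with [alpha < delta] and [inner p] stabilizes
   the level [a alpha].  At a limit this holds because an automorphism [s] of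
   [G_alpha], viewed in [Sym (G_alpha)], conjugates the right translation by [x]
   to the right translation by [s x].  Multiplicativity and the group axioms
   then follow by induction on [alpha]; injectivity holds because the levels
   have trivial centre, so that [g alpha] is determined by the restriction of
   [inner (g alpha)] to the level [a alpha]. *)

Section Development.

Set Implicit Arguments.
Unset Strict Implicit.
Unset Printing Implicit Defensive.

Local Open Scope classical_set_scope.
Local Open Scope group_scope.
Import Order.TTheory.

(** * Symmetric groups on at least three points *)

Lemma inj_surj_bijective (U V : Type) (f : U -> V) :
  injective f -> (forall y, exists x, f x = y) -> bijective f.
Proof. by move=> finj /choice [f' fK]; exists f' => // x; exact/finj/fK. Qed.

(** This condition forces [Sym U] to have trivial centre, and it passes along injections, so it can
    be carried from the base to every level, finite or infinite. *)
Definition three_points (U : Type) : Prop :=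
  exists u v w : U, [/\ u <> v, v <> w & u <> w].

Lemma three_points_inj (U V : Type) (f : U -> V) :
  injective f -> three_points U -> three_points V.
Proof.
move=> finj [u [v [w [uv vw uw]]]]; exists (f u), (f v), (f w).
by split=> /finj.
Qed.

Section ThreePoints.
Variable U : Type.
Implicit Types (x y z : U) (s t : Sym U).

Lemma three_points_avoid x y : three_points U -> exists z, z <> x /\ z <> y.
Proof.
move=> [u [v [w [uv vw uw]]]].
have [ux|ux] := pselect (u = x).
  have [vy|vy] := pselect (v = y).
    by exists w; split=> wE; [apply: uw; rewrite ux|apply: vw; rewrite vy].
  by exists v; split=> // vx; apply: uv; rewrite ux.
have [uy|uy] := pselect (u = y); last by exists u.
have [vx|vx] := pselect (v = x).
  by exists w; split=> wE; [apply: vw; rewrite vx|apply: uw; rewrite uy].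
by exists v; split=> // vy; apply: uv; rewrite uy.
Qed.

Definition swap_fun x y z : U :=
  if `[< z = x >] then y else if `[< z = y >] then x else z.

Lemma swap_funL x y : swap_fun x y x = y.
Proof. by rewrite /swap_fun asboolT. Qed.

Lemma swap_funR x y : swap_fun x y y = x.
Proof. by rewrite /swap_fun; case: asboolP => [->//|_]; rewrite asboolT. Qed.

Lemma swap_funD x y z : z <> x -> z <> y -> swap_fun x y z = z.
Proof. by move=> zx zy; rewrite /swap_fun !asboolF. Qed.

Lemma swap_funK x y : involutive (swap_fun x y).
Proof.
move=> z; have [->|zx] := pselect (z = x); first by rewrite swap_funL swap_funR.
have [->|zy] := pselect (z = y); first by rewrite swap_funR swap_funL.
by rewrite !swap_funD.
Qed.

Definition swap x y : Sym U := MkSym (Bijective (swap_funK x y) (swap_funK x y)).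

(** If [s] moved [x], a third point [z] would give a transposition [swap (s x) z] that fixes [x] but
    moves [s x], so it could not commute with [s]. *)
Lemma Sym_centerless s :
  three_points U -> (forall t, commute s t) -> s = 1.
Proof.
move=> U3 sC; apply: sym_ext => x /=; apply: contrapT => sx.
have [z [zx zsx]] := three_points_avoid x (s x) U3.
have := congr1 (fun t : Sym U => t x) (sC (swap (s x) z)).
rewrite !sym_mulE /= swap_funL swap_funD; [|exact/nesym|exact/nesym].
by move/esym.
Qed.

Lemma three_points_Sym : three_points U -> three_points (Sym U).
Proof.
move=> [u [v [w [uv vw uw]]]]; exists 1, (swap u v), (swap v w).
(* The values at [u] and [v] already separate the three permutations: they are [(u, v)], [(v, u)]
   and [(u, w)]. *)
split=> /(congr1 (fun t : Sym U => (t u, t v))) [];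
  rewrite /= ?swap_funL ?swap_funR ?(swap_funD uv uw) //.
Qed.

End ThreePoints.

(** * Homomorphisms, inner automorphisms and centralizers *)

Section Multiplicative.
Variables (G H : groupType) (f : {multiplicative G -> H}).

Lemma multiplicative1 : f 1 = 1.
Proof. by apply: (@mulgI _ (f 1)); rewrite -gmulfM !mulg1. Qed.

Lemma multiplicativeV x : f x^-1 = (f x)^-1.
Proof.
by apply: (@mulgI _ (f x)); rewrite -gmulfM !mulgV multiplicative1.
Qed.

End Multiplicative.

Section Inner.
Variable G : groupType.
Implicit Types (S : set G) (p q x y : G).

Lemma inner1 x : inner 1 x = x.
Proof. by rewrite /inner mul1g invg1 mulg1. Qed.

Lemma innerM p q x : inner (p * q) x = inner p (inner q x).
Proof. by rewrite /inner invgM !mulgA. Qed.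

Lemma inner_comp p q : inner p \o inner q = inner (p * q).
Proof. by apply/funext => x; rewrite innerM. Qed.

Lemma inner_morph p : {morph inner p : x y / x * y}.
Proof. by move=> x y; rewrite /inner !mulgA mulgVK. Qed.

Lemma inner_arg1 p : inner p 1 = 1.
Proof. by rewrite /inner mulg1 mulgV. Qed.

Lemma innerK p : cancel (inner p) (inner p^-1).
Proof. by move=> x; rewrite -innerM mulVg inner1. Qed.

Lemma innerKV p : cancel (inner p^-1) (inner p).
Proof. by move=> x; rewrite -innerM mulgV inner1. Qed.

Lemma inner_inj p : injective (inner p).
Proof. exact: can_inj (innerK p). Qed.

Lemma inner_commute p x : commute p x -> inner p x = x.
Proof. by move=> px; rewrite /inner px mulgK. Qed.

Lemma commute_inner p x : inner p x = x -> commute p x.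
Proof. by move=> pxE; rewrite /commute -{2}pxE /inner mulgVK. Qed.

(** Moving [inner p] past [inner q] twists [q] by [inner p]; this is the twist that appears in the
    product [mulGA]. *)
Lemma inner_conj p q x : inner p (inner q x) = inner (inner p q) (inner p x).
Proof. by rewrite -!innerM /inner mulgVK. Qed.

(** The equivalence says that conjugation by [p] maps [S] onto [S], not merely into it, so the
    property passes to [p^-1]. *)
Definition stabilizes S p : Prop := forall x, S (inner p x) <-> S x.

Lemma stabilizes1 S : stabilizes S 1.
Proof. by move=> x; rewrite inner1. Qed.

Lemma stabilizesV S p : stabilizes S p -> stabilizes S p^-1.
Proof. by move=> Sp x; rewrite -[X in _ <-> S X](innerKV p) Sp. Qed.

(** Conjugation by [p] carries both [L] and [H] to themselves, hence also the centralizer. This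
    keeps the twisted factors of [mulGA] in the required centralizers. *)
Lemma centralizer_inner L H p x :
  stabilizes L p -> stabilizes H p -> centralizer_in L H x ->
  centralizer_in L H (inner p x).
Proof.
move=> Lp Hp [Lx Hx]; split; first exact/Lp.
move=> y Hy; have /Hx xy : H (inner p^-1 y) by apply/(stabilizesV Hp).
by rewrite -(innerKV p y) /commute -!inner_morph xy.
Qed.

Lemma centralizer_in1 (L H : set G) : L 1 -> centralizer_in L H 1.
Proof. by move=> L1; split=> // y _; exact: commute_sym (commute1 y). Qed.

Lemma centralizer_inM (L H : set G) x y : (forall u v, L u -> L v -> L (u * v)) ->
  centralizer_in L H x -> centralizer_in L H y -> centralizer_in L H (x * y).
Proof.
move=> LM [Lx Hx] [Ly Hy]; split; first exact: LM.
by move=> z Hz; apply/commute_sym/commuteM; apply/commute_sym; [apply: Hx|apply: Hy].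
Qed.

Lemma centralizer_inV (L H : set G) x : (forall u, L u -> L u^-1) ->
  centralizer_in L H x -> centralizer_in L H x^-1.
Proof.
move=> LV [Lx Hx]; split; first exact: LV.
by move=> z Hz; apply/commute_sym/commuteV/commute_sym/Hx.
Qed.

End Inner.

(** * Successors and limits in a well-order *)

Section WellOrder.
Variables (d : Order.disp_t) (K : orderType d).
Hypothesis K_wf : well_founded (fun alpha beta : K => (alpha < beta)%O).
Implicit Types (alpha beta gamma : K).

Lemma ex_least (P : K -> Prop) :
  (exists alpha, P alpha) -> exists2 m, P m & forall beta, P beta -> (m <= beta)%O.
Proof.
move=> [alpha]; elim/(well_founded_ind K_wf): alpha => alpha IH Palpha.
have [[beta [Pbeta ltab]]|noP] := pselect (exists beta, P beta /\ (beta < alpha)%O).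
  exact: IH Pbeta.
exists alpha => // beta Pbeta; rewrite leNgt; apply/negP => ltba.
by apply: noP; exists beta.
Qed.

Lemma is_succ_next alpha : (exists beta, (alpha < beta)%O) ->
  is_succ alpha (Defs.next alpha).
Proof. by move=> /ex_least [m am mP]; apply: xgetPex; exists m. Qed.

Lemma is_succ_inj alpha beta gamma :
  is_succ alpha beta -> is_succ alpha gamma -> beta = gamma.
Proof.
move=> [ab bP] [ag gP]; apply/eqP; rewrite eq_le; apply/andP.
by split; [apply: bP|apply: gP].
Qed.

(** [prev] returns [None] both at zero and at limits; for a non-limit index only these two cases
    remain. *)
Variant prev_spec alpha : option {beta | is_succ beta alpha} -> Prop :=
  | PrevZero : is_zero alpha -> prev_spec None
  | PrevSucc beta (h : is_succ beta alpha) : prev_spec (Some (exist _ beta h)).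

Lemma prevP alpha : ~ is_limit alpha -> prev_spec (Defs.prev alpha).
Proof.
move=> nl; rewrite /Defs.prev; case: pselect => [ex|nex]; first by constructor.
constructor; apply: contrapT => nz; apply: nl; split=> // beta h.
by apply: nex; exists beta.
Qed.

Lemma limit_lt alpha beta gamma : is_limit gamma -> (beta < gamma)%O ->
  is_succ beta alpha -> (alpha < gamma)%O.
Proof.
move=> [_ gl] bg sba; rewrite lt_neqAle; apply/andP; split; last exact: sba.2.
by apply/eqP => ag; apply: (gl beta); rewrite -ag.
Qed.

Lemma ex_lt_limit gamma : is_limit gamma -> exists alpha, (alpha < gamma)%O.
Proof.
move=> gl; apply: contrapT => nex; apply: gl.1 => alpha; rewrite leNgt.
by apply/negP => ltag; apply: nex; exists alpha.
Qed.

Lemma not_succ_limit alpha gamma : (alpha < gamma)%O ->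
  (forall beta, ~ is_succ beta gamma) -> is_limit gamma.
Proof. by move=> ag ns; split=> // /(_ alpha); rewrite leNgt ag. Qed.

End WellOrder.

(** * Levels as subgroups, and conjugation by permutations of a level *)

Section Levels.
Variables (d : Order.disp_t) (K : orderType d) (B G : groupType).
Variable T : regular_limit K B G.
Implicit Types (alpha beta gamma : K) (x y p : G).

Lemma level1 alpha : level T alpha 1.
Proof. by apply/set_mem; have [] := level_group T alpha. Qed.

Lemma levelM alpha x y : level T alpha x -> level T alpha y -> level T alpha (x * y).
Proof.
move=> /mem_set lx /mem_set ly; apply/set_mem.
exact: (group_closedM (level_group T alpha)).
Qed.

Lemma levelV alpha x : level T alpha x -> level T alpha x^-1.
Proof.
by move=> /mem_set lx; apply/set_mem; exact: (group_closedV (level_group T alpha)).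
Qed.

Lemma level_inner alpha p x :
  level T alpha p -> level T alpha x -> level T alpha (inner p x).
Proof. by move=> lp lx; apply: levelM; [exact: levelM|exact: levelV]. Qed.

Lemma stabilizes_level alpha p : level T alpha p -> stabilizes (level T alpha) p.
Proof.
move=> lp x; split; last exact: level_inner.
by move=> /(level_inner (levelV lp)); rewrite innerK.
Qed.

Lemma level_perm_elt alpha s : level T (Defs.next alpha) (perm_elt T alpha s).
Proof. by rewrite -(level_next T alpha).2; exists s. Qed.

Lemma right_translation alpha (x : level T alpha) :
  exists s : Sym (level T alpha), forall y : level T alpha, val (s y) = val y * (val x)^-1.
Proof.
pose f (y : level T alpha) : level T alpha :=
  SigSub (mem_set (levelM (set_valP y) (levelV (set_valP x)))).
pose f' (y : level T alpha) : level T alpha :=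
  SigSub (mem_set (levelM (set_valP y) (set_valP x))).
have fK : cancel f f' by move=> y; apply: val_inj; rewrite /= mulgVK.
have f'K : cancel f' f by move=> y; apply: val_inj; rewrite /= mulgK.
by exists (MkSym (Bijective fK f'K)).
Qed.

(* [s] conjugates the right translation by [x] to the one by [s x]. *)
Lemma inner_perm_elt alpha (s : Sym (level T alpha)) (f : G -> G) :
  (forall x : level T alpha, val (s x) = f (val x)) ->
  (forall x y, level T alpha x -> level T alpha y -> f (x * y) = f x * f y) ->
  forall x, level T alpha x -> inner (perm_elt T alpha s) x = f x.
Proof.
move=> sE fM x0 lx0; pose x : level T alpha := SigSub (mem_set lx0).
have [r rE] := right_translation x.
rewrite -[x0]/(val x) -sE -(level_regular rE) /inner -multiplicativeV -!gmulfM.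
apply: level_regular => y; rewrite !sym_mulE.
(* Writing [y] as [s (s^-1 y)] expresses both sides through [f], and the goal becomes
   multiplicativity of [f] on the level. *)
have -> : val y = val (s (s^-1 y)) by rewrite -sym_mulE mulgV.
rewrite !sE rE; set z := val _.
have lz : level T alpha z by exact: set_valP.
apply: (canRL (mulgK _)); rewrite -fM //; first by rewrite mulgVK.
by apply: levelM => //; exact: levelV.
Qed.

(** * Trivial centre of the levels *)

Hypothesis K_wf : well_founded (fun alpha beta : K => (alpha < beta)%O).
Hypothesis K_nomax : forall alpha, exists beta, (alpha < beta)%O.
Hypothesis B3 : three_points B.

Lemma level_succ alpha beta : is_succ alpha beta -> Defs.next alpha = beta.
Proof. by apply: is_succ_inj; apply: is_succ_next. Qed.

Lemma three_points_zero alpha : is_zero alpha -> three_points (level T alpha).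
Proof.
move=> /(level_base T) [f [finj fr]].
have lf b : f b \in level T alpha by apply/mem_set; rewrite -fr; exists b.
apply: (@three_points_inj _ _ (fun b => SigSub (lf b)) _ B3) => b c.
by move=> /(congr1 val) /finj.
Qed.

(** The base embeds onto the least level, and the least level is contained in all the others. *)
Lemma three_points_level alpha : three_points (level T alpha).
Proof.
have [z _ z0] : exists2 m : K, True & forall beta, True -> (m <= beta)%O.
  by apply: ex_least => //; exists alpha.
have zP : is_zero z by move=> beta; apply: z0.
have lz (u : level T z) : val u \in level T alpha.
  by apply/mem_set/(level_mono (zP alpha))/set_valP.
apply: (@three_points_inj _ _ (fun u => SigSub (lz u)) _ (three_points_zero zP)).
move=> u v.
by move=> /(congr1 val) uv; apply: val_inj.
Qed.

Hypothesis B_centerless : forall b : B, (forall c, commute b c) -> b = 1.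

(** Induction on [alpha]. At a limit, [x] already lies in an earlier level and is central there; at
    zero the level is a copy of [B]; at a successor it is the symmetric group of a level with at
    least three points. *)
Lemma level_centerless alpha x : level T alpha x ->
  (forall y, level T alpha y -> commute x y) -> x = 1.
Proof.
elim/(well_founded_ind K_wf): alpha => alpha IH lx xC.
have [lim|nl] := pselect (is_limit alpha).
  have := lx; rewrite level_limit // => -[beta ltba lbx].
  apply: (IH beta) => // y lby; apply: xC.
  exact: level_mono (ltW ltba) _ lby.
case: (prevP nl) => [zero|beta sba].
  have [f [finj fr]] := level_base T zero.
  have := lx; rewrite -fr => -[b _ bx]; rewrite -bx.
  suff -> : b = 1 by rewrite multiplicative1.
  apply: B_centerless => c; apply: finj; rewrite !gmulfM bx.
  by apply: xC; rewrite -fr; exists c.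
have [pinj pr] := level_next T beta; rewrite (level_succ sba) in pr.
have := lx; rewrite -pr => -[s _ sx]; rewrite -sx.
suff -> : s = 1 by rewrite multiplicative1.
apply: Sym_centerless => [|t]; first exact: three_points_level.
by apply: pinj; rewrite !gmulfM sx; apply: xC; rewrite -pr; exists t.
Qed.

(** * Continuity of the enumeration of the club *)

Variables (A : set K) (a : K -> K).
Hypothesis clubA : club A.
Hypothesis enumA : increasing_enum a A.

Lemma enum_le alpha beta : (alpha <= beta)%O -> (a alpha <= a beta)%O.
Proof. by rewrite le_eqVlt => /predU1P[->//|/enumA.1/ltW]. Qed.

Lemma level_enum alpha beta x :
  (alpha <= beta)%O -> level T (a alpha) x -> level T (a beta) x.
Proof. by move=> /enum_le leab lx; exact: level_mono leab _ lx. Qed.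

Lemma level_enum_cover x : exists alpha, level T (a alpha) x.
Proof.
have : [set: G] x by []; rewrite -(level_union T) => -[beta _ lx].
have [gamma Ag ltbg] := clubA.1 beta.
have := Ag; rewrite -enumA.2 => -[alpha _ aE]; exists alpha; rewrite aE.
exact: level_mono (ltW ltbg) _ lx.
Qed.

(* The supremum of the [a alpha], [alpha < gamma], is a limit, so it lies in the
   closed set [A]. *)
Lemma enum_limit_sup gamma beta : is_limit gamma -> (beta < a gamma)%O ->
  exists2 alpha, (alpha < gamma)%O & (beta < a alpha)%O.
Proof.
move=> gl ltb.
pose ub m := forall alpha, (alpha < gamma)%O -> (a alpha <= m)%O.
have [sigma sub sleast] : exists2 m, ub m & forall m', ub m' -> (m <= m')%O.
  by apply: (ex_least K_wf); exists (a gamma) => alpha /ltW; exact: enum_le.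
have sub_lt alpha : (alpha < gamma)%O -> (a alpha < sigma)%O.
  move=> ltag; have sa := is_succ_next K_wf (K_nomax alpha).
  exact: lt_le_trans (enumA.1 _ _ sa.1) (sub _ (limit_lt gl ltag sa)).
have sup delta : (delta < sigma)%O ->
    exists2 alpha, (alpha < gamma)%O & (delta < a alpha)%O.
  move=> ltds; apply: contrapT => nex.
  have /sleast : ub delta.
    move=> alpha ltag; rewrite leNgt; apply/negP => ltda; apply: nex.
    by exists alpha.
  by rewrite leNgt ltds.
have [alpha0 lta0] := ex_lt_limit gl.
have slim : is_limit sigma.
  apply: not_succ_limit (sub_lt _ lta0) _ => delta [ltds sdelta].
  have [alpha ltag ltda] := sup _ ltds.
  by have := sub_lt _ ltag; rewrite ltNge sdelta.
have : A sigma.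
  apply: clubA.2 => // delta /sup [alpha ltag ltda].
  exists (a alpha); first by rewrite -enumA.2; exists alpha.
  by rewrite ltda sub_lt.
(* The point [sigma] of [A] is some [a eps], and [eps < gamma] would give [sigma < sigma]; hence
   [a gamma <= sigma]. *)
rewrite -enumA.2 => -[eps _ epsE]; apply: sup; apply: lt_le_trans ltb _.
rewrite -epsE; apply: enum_le; rewrite leNgt; apply/negP => /sub_lt.
by rewrite epsE ltxx.
Qed.

Lemma enum_limit gamma : is_limit gamma -> is_limit (a gamma).
Proof.
move=> gl; have [alpha /enumA.1 lta] := ex_lt_limit gl.
apply: not_succ_limit lta _ => beta [ltb sb].
have [delta ltdg /sb] := enum_limit_sup gl ltb.
by rewrite leNgt enumA.1.
Qed.

(** As [a gamma] is itself a limit, its level is the union of the levels below it, and continuity of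
    [a] makes the levels [a alpha] with [alpha < gamma] cofinal among these. *)
Lemma level_enum_limit gamma x : is_limit gamma -> level T (a gamma) x ->
  exists2 alpha, (alpha < gamma)%O & level T (a alpha) x.
Proof.
move=> gl; rewrite (level_limit T (enum_limit gl)) => -[beta ltb lx].
have [alpha ltag /ltW ltba] := enum_limit_sup gl ltb.
by exists alpha => //; apply: level_mono ltba _ lx.
Qed.

End Levels.

(** * Group axioms from right inverses, and the group of level preserving automorphisms *)

Lemma is_group_right_inv (X : Type) (S : set X) (op : X -> X -> X) (e : X) :
  (forall x y, S x -> S y -> S (op x y)) ->
  (forall x y z, S x -> S y -> S z -> op x (op y z) = op (op x y) z) ->
  S e -> (forall x, S x -> op e x = x /\ op x e = x) ->
  (forall x, S x -> exists2 y, S y & op x y = e) -> is_group S op.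
Proof.
move=> opS opA Se op1 opV; split=> //; exists e; split=> // x Sx.
(* The right inverse [y] has a right inverse [z] of its own, and [y x = y x y z = y z = e]. *)
have [y Sy xy] := opV x Sx; have [z Sz yz] := opV y Sy.
exists y; split=> //.
have Syx := opS _ _ Sy Sx.
by rewrite -[LHS](op1 _ Syx).2 -yz opA // -(opA y x y) // xy (op1 y Sy).2.
Qed.

Lemma is_group_AutA (d : Order.disp_t) (K : orderType d) (B G : groupType)
    (T : regular_limit K B G) (A : set K) :
  is_group (AutA T A) (fun phi psi : G -> G => phi \o psi).
Proof.
apply: (@is_group_right_inv _ _ _ id) => //.
- move=> f f' [fb fM fA] [fb' fM' fA']; split.
  + exact: bij_comp.
  + by move=> x y /=; rewrite fM' fM.
  + by move=> alpha Aalpha; rewrite -image_comp fA' // fA.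
- by split=> [||alpha _]; [exists id|by []|rewrite image_id].
move=> f [[f' fK f'K] fM fA]; exists f'; last exact/funext.
split; first by exists f.
  by move=> x y; apply: (can_inj fK); rewrite fM !f'K.
move=> alpha Aalpha; rewrite -{1}(fA _ Aalpha) image_comp.
by rewrite (_ : f' \o f = id) ?image_id //; apply/funext.
Qed.

(** * The automorphisms [Phi_at] and their union *)

Section LevelPreserving.
Variables (d : Order.disp_t) (K : orderType d) (kappa : infinite_cardinal K).
Variables (B G : groupType) (T : regular_limit K B G).
Variables (A : set K) (a : K -> K).
Hypothesis clubA : club A.
Hypothesis enumA : increasing_enum a A.
Implicit Types (alpha beta gamma : K) (x y p : G) (g h k : nonlimit K -> G).

Let K_wf := cardinal_wf kappa.

Let K_nomax alpha : exists beta, (alpha < beta)%O.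
Proof. by have [beta _ ltab] := clubA.1 alpha; exists beta. Qed.

Notation L alpha := (level T (a alpha)).
Notation phi := (Phi_at kappa T a).
Notation phi_prev := (Phi_prev kappa T a).

Let L_le alpha beta x : (alpha <= beta)%O -> L alpha x -> L beta x.
Proof. exact: (level_enum enumA). Qed.

Let L_lt alpha beta x : (alpha < beta)%O -> L alpha x -> L beta x.
Proof. by move=> /ltW leab; exact: L_le. Qed.

Let L_limit gamma x : is_limit gamma -> L gamma x ->
  exists2 alpha, (alpha < gamma)%O & L alpha x.
Proof. exact: (level_enum_limit K_wf K_nomax clubA enumA). Qed.

Let L_limit2 gamma x y : is_limit gamma -> L gamma x -> L gamma y ->
  exists2 alpha, (alpha < gamma)%O & L alpha x /\ L alpha y.
Proof.
move=> gl /(L_limit gl)[alpha ltag lx] /(L_limit gl)[beta ltbg ly].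
exists (Order.max alpha beta); first by rewrite gt_max ltag.
by split; [apply: L_le lx|apply: L_le ly]; rewrite le_max lexx ?orbT.
Qed.

Lemma Phi_at_step g alpha :
  phi g alpha = Phi_step T a g (fun beta (_ : (beta < alpha)%O) => phi g beta).
Proof.
rewrite /Phi_at Fix_eq // => beta F F' FF'; congr Phi_step.
by apply: functional_extensionality_dep => gamma; apply/funext.
Qed.

Lemma Phi_at_limit g gamma : is_limit gamma ->
  phi g gamma = inner (as_element T (a gamma)
    (Defs.glue T a (fun beta (_ : (beta < gamma)%O) => phi g beta))).
Proof. by move=> gl; rewrite Phi_at_step /Phi_step; case: pselect. Qed.

Lemma Phi_at_nonlimit g (alpha : nonlimit K) :
  phi g (sval alpha) = inner (g alpha) \o phi_prev g (sval alpha).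
Proof.
case: alpha => alpha nl; rewrite Phi_at_step /Phi_step; case: pselect => //= nl'.
by rewrite (Prop_irrelevance nl' nl).
Qed.

(** Agreement on overlaps makes the union of graphs single-valued at [x], so the choice made by
    [xget] is forced. *)
Lemma glue_eq (P : K -> Prop) (F : forall alpha, P alpha -> G -> G) alpha
    (Palpha : P alpha) x :
  (forall beta (Pbeta : P beta), L beta x -> F beta Pbeta x = F alpha Palpha x) ->
  L alpha x -> Defs.glue T a F x = F alpha Palpha x.
Proof.
move=> FF lx; apply: xget_unique => [|y [beta [Pbeta [lbx ->]]]]; last exact: FF.
by exists alpha, Palpha.
Qed.

Lemma as_element_eq alpha (f : G -> G) (s : Sym (level T alpha)) :
  (forall x : level T alpha, val (s x) = f (val x)) ->
  as_element T alpha f = perm_elt T alpha s.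
Proof.
move=> sE; apply: xget_unique => [|y [t [tE ->]]]; first by exists s.
by congr (perm_elt T alpha _); apply: sym_ext => u; apply: val_inj; rewrite sE tE.
Qed.

(** The invariant of the recursion. The bound [alpha < delta] is strict because at a limit [p] is
    only known to lie in the level following [a alpha]; stabilization of the level [a alpha] is
    therefore recorded separately. *)
Record Phi_at_spec g alpha p : Prop := {
  Phi_at_inner : phi g alpha = inner p;
  Phi_at_level : forall delta, (alpha < delta)%O -> L delta p;
  Phi_at_stab : stabilizes (L alpha) p;
  Phi_at_coherent : forall beta x, (beta < alpha)%O -> L beta x ->
    phi g alpha x = phi g beta x }.

(** The invariant below [alpha] is a hypothesis so that the lemma can serve inside the induction of
    [Phi_atP]. The predecessor lies strictly below [alpha], which puts [p] in the level of
    [alpha]. *)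
Lemma Phi_prev_inner g (alpha : nonlimit K) :
  (forall beta, (beta < sval alpha)%O -> exists p, Phi_at_spec g beta p) ->
  exists p, [/\ phi_prev g (sval alpha) = inner p, L (sval alpha) p &
    stabilizes (prev_level T a (sval alpha)) p].
Proof.
case: alpha => alpha nl /= spec; rewrite /prev_level /Phi_prev.
case: (prevP nl) => [_|beta sba].
  exists 1; split; [by apply/funext => x; rewrite inner1|exact: level1|].
  exact: stabilizes1.
have [p [phiE lp stab _]] := spec beta sba.1.
by exists p; split=> //; exact: lp sba.1.
Qed.

(* [perm_elt T (a gamma) s] is psi_gamma. *)
Lemma Phi_at_limit_perm g gamma : is_limit gamma ->
  (forall beta, (beta < gamma)%O -> exists p, Phi_at_spec g beta p) ->
  exists s : Sym (L gamma), phi g gamma = inner (perm_elt T (a gamma) s) /\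
    forall beta (x : L gamma), (beta < gamma)%O -> L beta (val x) ->
      val (s x) = phi g beta (val x).
Proof.
move=> gl spec.
pose f := Defs.glue T a (fun beta (_ : (beta < gamma)%O) => phi g beta).
have fE beta x : (beta < gamma)%O -> L beta x -> f x = phi g beta x.
  move=> ltbg lbx; rewrite /f.
  apply: (@glue_eq _ (fun beta (_ : (beta < gamma)%O) => phi g beta) _ ltbg) => //.
  move=> delta ltdg ldx; case: (ltgtP beta delta) => [ltbd|ltdb|->//].
    by have [p pP] := spec _ ltdg; rewrite (Phi_at_coherent pP ltbd).
  by have [p pP] := spec _ ltbg; rewrite (Phi_at_coherent pP ltdb).
have fL (u : L gamma) : f (val u) \in L gamma.
  apply/mem_set; have [beta ltbg lbu] := L_limit gl (set_valP u).
  have [p [phiE _ stab _]] := spec _ ltbg.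
  by rewrite (fE beta) // phiE; apply: L_lt ltbg _; apply/stab.
pose F (u : L gamma) : L gamma := SigSub (fL u).
(* Two points of a limit level lie in a common earlier level, where [f] is the restriction of one
   inner automorphism. *)
have Finj : injective F.
  move=> u v /(congr1 val) /= fuv; apply: val_inj.
  have [beta ltbg [lbu lbv]] := L_limit2 gl (set_valP u) (set_valP v).
  move: fuv; rewrite !(fE beta) //.
  by have [p [-> _ _ _]] := spec _ ltbg; exact: inner_inj.
have Fsurj v : exists u, F u = v.
  have [beta ltbg lbv] := L_limit gl (set_valP v).
  have [p [phiE _ stab _]] := spec _ ltbg.
  (* The preimage of [v] under stage [beta] stays in the same level, so it lies in the domain on
     which [f] agrees with that stage. *)
  have lbu : L beta (inner p^-1 (val v)) by apply/stabilizesV.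
  exists (SigSub (mem_set (L_lt ltbg lbu))); apply: val_inj => /=.
  by rewrite (fE beta) // phiE innerKV.
pose s := MkSym (inj_surj_bijective Finj Fsurj).
exists s; split; last by move=> beta x ltbg lbx; rewrite /= (fE beta).
by rewrite Phi_at_limit // (@as_element_eq _ _ s).
Qed.

Section Element.
Variable g : nonlimit K -> G.
Hypothesis gGA : GA T a g.

Lemma Phi_atP alpha : exists p, Phi_at_spec g alpha p.
Proof.
elim/(well_founded_ind K_wf): alpha => alpha IH.
have [gl|nl] := pselect (is_limit alpha); last first.
  have [lg cg] := gGA (exist _ alpha nl).
  have [p [prevE lp _]] := @Phi_prev_inner g (exist _ alpha nl) IH.
  have phiE := Phi_at_nonlimit g (exist _ alpha nl).
  rewrite /= in lg cg prevE lp phiE.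
  have lgp := levelM lg lp.
  have stab := stabilizes_level lgp.
  exists (g (exist _ alpha nl) * p); split=> //.
  - by rewrite phiE prevE inner_comp.
  - by move=> delta ltad; exact: L_lt lgp.
  move=> beta x ltba lbx; rewrite phiE /=.
  move: cg prevE; rewrite /prev_level /Phi_prev.
  case: (prevP nl) => [zero|delta sda] cg prevE.
    by have := zero beta; rewrite leNgt ltba.
  have lebd : (beta <= delta)%O.
    by rewrite leNgt; apply/negP => /sda.2; rewrite leNgt ltba.
  have [q qspec] := IH delta sda.1.
  (* The factor [g alpha] centralizes the level of the predecessor [delta], which contains the image
     of [x] under [phi g delta]. *)
  rewrite inner_commute.
    move: lebd; rewrite le_eqVlt => /predU1P[->//|ltbd].
    exact: Phi_at_coherent qspec _ _ ltbd lbx.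
  apply: cg; rewrite (Phi_at_inner qspec); apply/(Phi_at_stab qspec).
  exact: L_le lebd lbx.
have [s [phiE sE]] := Phi_at_limit_perm gl IH.
(* [f] extends [s] to all of [G]; the default 1 is taken only outside the level. *)
pose f x := oapp (fun u => val (s u)) 1 (insub x : option (L alpha)).
have fE (u : L alpha) : f (val u) = val (s u) by rewrite /f valK.
have fphi beta x : (beta < alpha)%O -> L beta x -> f x = phi g beta x.
  move=> ltba lbx; have lx := L_lt ltba lbx.
  by rewrite -[x]/(val (SigSub (mem_set lx) : L alpha)) fE (sE beta).
have phif x : L alpha x -> phi g alpha x = f x.
  move=> lx; rewrite phiE; apply: inner_perm_elt lx => [u|y z ly lz].
    by rewrite fE.
  have [beta ltba [lby lbz]] := L_limit2 gl ly lz.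
  rewrite !(fphi beta) //; last exact: levelM.
  by have [p [-> _ _ _]] := IH _ ltba; exact: inner_morph.
exists (perm_elt T (a alpha) s); split=> //.
(* The permutation lies in the level next after [a alpha], and [a delta] is at least that
   successor. *)
- move=> delta ltad; have := level_perm_elt s; apply: level_mono.
  by apply: (is_succ_next K_wf _).2; [exact: K_nomax|exact: enumA.1].
- move=> x; rewrite -phiE; split=> [lphi|lx].
    (* The preimage of [v] under [s] has the same image as [x], so injectivity of conjugation places
       [x] in the level. *)
    pose v : L alpha := SigSub (mem_set lphi).
    suff -> : x = val (s^-1 v) by exact: set_valP.
    apply: (@inner_inj _ (perm_elt T (a alpha) s)); rewrite -phiE.
    by rewrite (phif _ (set_valP (s^-1 v))) fE -sym_mulE mulgV.
  by rewrite phif // -[x]/(val (SigSub (mem_set lx) : L alpha)) fE; exact: set_valP.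
- move=> beta x ltba lbx; rewrite phif ?(fphi beta) //.
  exact: L_lt lbx.
Qed.

Lemma Phi_prevP (alpha : nonlimit K) :
  exists p, [/\ phi_prev g (sval alpha) = inner p, L (sval alpha) p &
    stabilizes (prev_level T a (sval alpha)) p].
Proof. by apply: Phi_prev_inner => beta _; exact: Phi_atP. Qed.

Lemma Phi_at_limitP gamma : is_limit gamma ->
  exists s : Sym (L gamma), phi g gamma = inner (perm_elt T (a gamma) s) /\
    forall beta (x : L gamma), (beta < gamma)%O -> L beta (val x) ->
      val (s x) = phi g beta (val x).
Proof. by move=> gl; apply: Phi_at_limit_perm gl _ => beta _; exact: Phi_atP. Qed.

Lemma Phi_at_le alpha beta x : (beta <= alpha)%O -> L beta x ->
  phi g alpha x = phi g beta x.
Proof.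
rewrite le_eqVlt => /predU1P[->//|ltba] lx; have [p pP] := Phi_atP alpha.
exact: Phi_at_coherent pP _ _ ltba lx.
Qed.

Lemma PhiE alpha x : L alpha x -> Phi kappa T a g x = phi g alpha x.
Proof.
move=> lx.
apply: (@glue_eq (fun=> True) (fun beta (_ : True) => phi g beta) alpha I) => //.
move=> beta _ lbx; have [ltab|leba] := ltP alpha beta.
  exact: Phi_at_le (ltW ltab) lx.
by rewrite (Phi_at_le leba).
Qed.

(** Any two elements lie in a common level of the club, where [Phi] agrees with an inner
    automorphism stabilizing that level. *)
Lemma Phi_AutA : AutA T A (Phi kappa T a g).
Proof.
have cover x : exists alpha, L alpha x := level_enum_cover T clubA enumA x.
have cover2 x y : exists alpha, L alpha x /\ L alpha y.
  have [alpha lx] := cover x; have [beta ly] := cover y.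
  exists (Order.max alpha beta).
  by split; [apply: L_le lx|apply: L_le ly]; rewrite le_max lexx ?orbT.
split.
- apply: inj_surj_bijective => [x y|y].
    have [alpha [lx ly]] := cover2 x y; have [p pP] := Phi_atP alpha.
    by rewrite !(PhiE (alpha := alpha)) // (Phi_at_inner pP); exact: inner_inj.
  have [alpha ly] := cover y; have [p pP] := Phi_atP alpha.
  exists (inner p^-1 y); rewrite (PhiE (alpha := alpha)).
    by rewrite (Phi_at_inner pP) innerKV.
  exact/(stabilizesV (Phi_at_stab pP)).
- move=> x y; have [alpha [lx ly]] := cover2 x y; have [p pP] := Phi_atP alpha.
  rewrite !(PhiE (alpha := alpha)) //; last exact: levelM.
  by rewrite (Phi_at_inner pP) inner_morph.
- move=> beta; rewrite -enumA.2 => -[alpha _ <-]; have [p pP] := Phi_atP alpha.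
  apply/seteqP; split=> [_ [x lx <-]|y ly].
    by rewrite (PhiE lx) (Phi_at_inner pP); apply/(Phi_at_stab pP).
  have lx : L alpha (inner p^-1 y) by apply/(stabilizesV (Phi_at_stab pP)).
  by exists (inner p^-1 y) => //; rewrite (PhiE lx) (Phi_at_inner pP) innerKV.
Qed.

End Element.

(** * The group structure on [GA] and multiplicativity *)

Lemma GA_mulGA g h : GA T a g -> GA T a h -> GA T a (mulGA kappa T a g h).
Proof.
move=> gGA hGA alpha; have [p [phiE lp stab]] := Phi_prevP gGA alpha.
apply: centralizer_inM => //; first by move=> u v; exact: levelM.
by rewrite phiE; apply: centralizer_inner => //; exact: stabilizes_level.
Qed.

Lemma Phi_prev_comp g h k alpha :
  (forall beta, (beta < alpha)%O -> phi k beta = phi g beta \o phi h beta) ->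
  phi_prev k alpha = phi_prev g alpha \o phi_prev h alpha.
Proof.
rewrite /Phi_prev; case: (Defs.prev alpha) => [[beta sba]|//].
by apply; exact: sba.1.
Qed.

(** At a non-limit index, [inner_conj] moves the previous stage of [g] past [h alpha]. At a limit
    all three stages are conjugations by permutations of one level, and these are compared pointwise
    at an earlier stage. *)
Lemma Phi_at_mulGA g h alpha : GA T a g -> GA T a h ->
  phi (mulGA kappa T a g h) alpha = phi g alpha \o phi h alpha.
Proof.
move=> gGA hGA; elim/(well_founded_ind K_wf): alpha => alpha IH.
have ghGA := GA_mulGA gGA hGA.
have [al|nl] := pselect (is_limit alpha); last first.
  pose al : nonlimit K := exist _ alpha nl.
  rewrite -[alpha]/(sval al) !Phi_at_nonlimit (Phi_prev_comp IH) /mulGA.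
  have [p [-> _ _]] := Phi_prevP gGA al.
  apply/funext => x /=.
  by rewrite innerM -inner_conj.
have [r [-> rE]] := Phi_at_limitP ghGA al.
have [s [-> sE]] := Phi_at_limitP gGA al.
have [t [-> tE]] := Phi_at_limitP hGA al.
rewrite inner_comp -gmulfM; congr (inner (perm_elt T _ _)).
apply: sym_ext => u; apply: val_inj; rewrite sym_mulE.
have [beta ltba lu] := L_limit al (set_valP u).
have [p pP] := Phi_atP hGA beta.
rewrite (rE beta) // (sE beta) // (tE beta) ?IH //.
by rewrite (Phi_at_inner pP); apply/(Phi_at_stab pP).
Qed.

Lemma Phi_prev_mulGA g h alpha : GA T a g -> GA T a h ->
  phi_prev (mulGA kappa T a g h) alpha = phi_prev g alpha \o phi_prev h alpha.
Proof.
by move=> gGA hGA; apply: Phi_prev_comp => beta _; exact: Phi_at_mulGA.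
Qed.

Let oneGA : nonlimit K -> G := fun=> 1.

Lemma GA_one : GA T a oneGA.
Proof. by move=> alpha; apply/centralizer_in1/level1. Qed.

Lemma Phi_at_one alpha : phi oneGA alpha = id.
Proof.
elim/(well_founded_ind K_wf): alpha => alpha IH.
have inner_id : @inner G 1 = id by apply/funext => x; rewrite inner1.
have [al|nl] := pselect (is_limit alpha); last first.
  rewrite -[alpha]/(sval (exist _ alpha nl : nonlimit K)) Phi_at_nonlimit inner_id.
  rewrite /Phi_prev /=; case: (Defs.prev alpha) => [[beta sba]|//].
  by rewrite (IH beta sba.1).
have [s [-> sE]] := Phi_at_limitP GA_one al.
suff -> : s = 1 by rewrite multiplicative1.
apply: sym_ext => u; apply: val_inj.
have [beta ltba lu] := L_limit al (set_valP u).
by rewrite (sE beta) // IH.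
Qed.

Lemma Phi_prev_one alpha : phi_prev oneGA alpha = id.
Proof.
by rewrite /Phi_prev; case: (Defs.prev _) => [[beta _]|//]; rewrite Phi_at_one.
Qed.

Lemma is_group_GA : is_group (GA T a) (mulGA kappa T a).
Proof.
apply: (@is_group_right_inv _ _ _ oneGA).
- exact: GA_mulGA.
- move=> g h k gGA hGA kGA; apply/funext => alpha.
  rewrite /mulGA -/(mulGA kappa T a g h) Phi_prev_mulGA //.
  have [p [-> _ _]] := Phi_prevP gGA alpha.
  by rewrite /= inner_morph mulgA.
- exact: GA_one.
- move=> g gGA; split; apply/funext => alpha; rewrite /mulGA.
    by rewrite Phi_prev_one mul1g.
  by have [p [-> _ _]] := Phi_prevP gGA alpha; rewrite inner_arg1 mulg1.
move=> g gGA.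
have /choice [h hP] : forall alpha : nonlimit K, exists y,
    centralizer_in (L (sval alpha)) (prev_level T a (sval alpha)) y /\
    g alpha * phi_prev g (sval alpha) y = 1.
  move=> alpha; have [p [-> lp stab]] := Phi_prevP gGA alpha.
  (* Each component of the inverse is obtained by undoing the previous stage of [g], so it depends
     on [g] alone and can be chosen without recursion. *)
  exists (inner p^-1 (g alpha)^-1); split; last by rewrite innerKV mulgV.
  apply: centralizer_inner; [exact/stabilizes_level/levelV|exact: stabilizesV|].
  by apply: centralizer_inV => // u; exact: levelV.
exists h; first by move=> alpha; have [] := hP alpha.
by apply/funext => alpha; exact: (hP alpha).2.
Qed.

Lemma Phi_mulGA g h : GA T a g -> GA T a h ->
  Phi kappa T a (mulGA kappa T a g h) = Phi kappa T a g \o Phi kappa T a h.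
Proof.
move=> gGA hGA; apply/funext => x.
have [alpha lx] := level_enum_cover T clubA enumA x.
have [p pP] := Phi_atP hGA alpha.
rewrite (PhiE (GA_mulGA gGA hGA) lx) Phi_at_mulGA //= (PhiE hGA lx).
by rewrite (PhiE gGA (alpha := alpha)) // (Phi_at_inner pP); apply/(Phi_at_stab pP).
Qed.

(** * Injectivity *)

Hypothesis B3 : three_points B.
Hypothesis B_centerless : forall b : B, (forall c, commute b c) -> b = 1.

Lemma Phi_inj g h : GA T a g -> GA T a h ->
  Phi kappa T a g = Phi kappa T a h -> g = h.
Proof.
move=> gGA hGA PhiEgh.
have prev_eq alpha : (forall beta, (beta < alpha)%O -> phi g beta = phi h beta) ->
    phi_prev g alpha = phi_prev h alpha.
  rewrite /Phi_prev; case: (Defs.prev alpha) => [[beta sba]|//].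
  by apply; exact: sba.1.
have g_eq (alpha : nonlimit K) :
    phi_prev g (sval alpha) = phi_prev h (sval alpha) -> g alpha = h alpha.
  move=> prevE; have [p [phiE lp _]] := Phi_prevP gGA alpha.
  (* This quotient is shown to be central in the level [a alpha], whose centre is trivial. *)
  suff : (h alpha)^-1 * g alpha = 1 by move=> /(canRL (mulVKg _)); rewrite mulg1.
  apply: (level_centerless K_wf K_nomax B3 B_centerless
    (T := T) (alpha := a (sval alpha))).
    have [[lg _] [lh _]] := (gGA alpha, hGA alpha).
    by apply: levelM => //; exact: levelV.
  move=> y ly; apply: commute_inner; rewrite innerM.
  (* Every [y] in the level is the image of a point of the level under the common previous stage;
     comparing both automorphisms at that point shows that [g alpha] and [h alpha] conjugate [y]
     alike. *)
  have lx : L (sval alpha) (inner p^-1 y) by apply/(stabilizesV (stabilizes_level lp)).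
  have := congr1 (fun f => f (inner p^-1 y)) PhiEgh.
  rewrite (PhiE gGA lx) (PhiE hGA lx) !Phi_at_nonlimit /= -prevE phiE innerKV.
  by move=> ->; rewrite innerK.
have phi_eq alpha : phi g alpha = phi h alpha.
  elim/(well_founded_ind K_wf): alpha => alpha IH.
  have [al|nl] := pselect (is_limit alpha); last first.
    rewrite -[alpha]/(sval (exist _ alpha nl : nonlimit K)) !Phi_at_nonlimit.
    by rewrite prev_eq // g_eq // prev_eq.
  rewrite !Phi_at_limit //; congr (inner (as_element _ _ (Defs.glue _ _ _))).
  by apply: functional_extensionality_dep => beta; apply/funext => ltba; exact: IH.
by apply/funext => alpha; apply/g_eq/prev_eq => beta _.
Qed.

Lemma group_monomorphism_Phi : group_monomorphism (GA T a) (mulGA kappa T a)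
  (AutA T A) (fun phi psi : G -> G => phi \o psi) (Phi kappa T a).
Proof.
split; [exact: is_group_GA|exact: is_group_AutA|exact: Phi_AutA| |exact: Phi_inj].
exact: Phi_mulGA.
Qed.

End LevelPreserving.

End Development.

Theorem theorem14 (d : Order.disp_t) (K : orderType d)
    (kappa : infinite_cardinal K) (n : nat) (n_ge7 : (7 <= n)%N)
    (G : groupType) (T : regular_limit K (Sym 'I_n) G)
    (cardG : ([set: G]%classic #= [set: K]%classic)%card)
    (card_level : forall alpha : K,
       (level T alpha #<= [set: K]%classic)%card /\ ~ ([set: K]%classic #<= level T alpha)%card)
    (A : set K) (clubA : club A)
    (a : K -> K) (enumA : increasing_enum a A) :
  group_monomorphism (GA T a) (mulGA kappa T a)
    (AutA T A) (fun phi psi : G -> G => phi \o psi) (Phi kappa T a).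
Proof.
(* Both conditions on the base, three points and trivial centre, come from three distinct points of
   ['I_n]. *)
have I3 : three_points 'I_n.
  case: n n_ge7 {T cardG card_level} => [|[|[|n]]] // _.
  by exists (@Ordinal n.+3 0 isT), (@Ordinal n.+3 1 isT), (@Ordinal n.+3 2 isT).
apply: group_monomorphism_Phi => //; first exact: three_points_Sym.
by move=> b; exact: Sym_centerless.
Qed.
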